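(* Let $G$ be a finite group of order $n=|G|$ with an irreducible unitary representation on a $d$-dimensional Hilbert space $\mathcal{H}$ (the representing unitary of $g\in G$ is also denoted $g$). Let $\rho$ be a quantum state on $\mathcal{H}$ and consider the geometrically uniform ensemble $(\frac1n,\rho_g)_{g\in G}$ with $\rho_g=g\rho g^\dagger$. Then the optimal error probability of the state exclusion problem for this ensemble, $$q^*=\min\Big\{\tfrac1n\sum_{g\in G}\operatorname{tr}(\Pi_g\rho_g):(\Pi_g)_{g\in G}\text{ a POVM on }\mathcal{H}\Big\},$$ is equal to $$q^*=\frac{d\,\lambda_{\min}(\rho)}{n}.$$ In particular, $q^*>0$ if and only if $\rho$ has full rank. Moreover, for any orthogonal projection $P$ of rank $k\ge1$ whose support is contained in the eigenspace of $\rho$ for the eigenvalue $\lambda_{\min}(\rho)$, the measurement $\Pi_g=\frac{d}{nk}\,gPg^\dagger$, $g\in G$, is a POVM attaining the minimum.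
   Context: A quantum state is a positive semidefinite operator of unit trace; $\lambda_{\min}(\rho)$ denotes the smallest eigenvalue of $\rho$ as an operator on $\mathcal{H}$. A POVM is a family $(\Pi_g)_{g\in G}$ of positive semidefinite operators with $\sum_{g}\Pi_g=\mathbb{I}$. *)

(* Defs.v *)
From mathcomp Require Import all_boot all_order all_algebra all_fingroup all_character.
From mathcomp Require Import boolp classical_sets reals.
From mathcomp Require Import complex.

Set Implicit Arguments.
Unset Strict Implicit.
Unset Printing Implicit Defensive.

Import Order.TTheory GRing.Theory Num.Theory.
Local Open Scope ring_scope.
Local Open Scope classical_set_scope.
Local Open Scope sesquilinear_scope.

(* The order of a numClosedFieldType C is the partial one: x <= y means that
   y - x is real and nonnegative.  In particular every element of a set is
   comparable to its minimum. *)
Definition is_minimum (C : numClosedFieldType) (S : set C) (m : C) : Prop :=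
  S m /\ lbound S m.

(* Junk value 0 when S has no minimum. *)
Definition minimum (C : numClosedFieldType) (S : set C) : C :=
  xget 0 [set m | is_minimum S m].

Lemma is_minimum_unique (C : numClosedFieldType) (S : set C) (m1 m2 : C) :
  is_minimum S m1 -> is_minimum S m2 -> m1 = m2.
Proof.
by move=> [S1 l1] [S2 l2]; apply/eqP; rewrite eq_le l1 // l2.
Qed.

Lemma minimumP (C : numClosedFieldType) (S : set C) (m : C) :
  is_minimum S m -> is_minimum S (minimum S).
Proof. exact: xgetI. Qed.

Lemma minimumE (C : numClosedFieldType) (S : set C) (m : C) :
  is_minimum S m -> minimum S = m.
Proof. by move=> Sm; apply: is_minimum_unique (minimumP Sm) Sm. Qed.

(* Kets are column vectors; M^t* is the adjoint of M. *)
Definition psdmx (C : numClosedFieldType) (d : nat) (A : 'M[C]_d) : Prop :=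
  A \is hermsymmx /\ forall u : 'cV[C]_d, 0 <= (u^t* *m A *m u) 0 0.

Definition quantum_state (C : numClosedFieldType) (d : nat) (rho : 'M[C]_d) :
    Prop :=
  psdmx rho /\ \tr rho = 1.

(* [eigenvalue], [eigenspace] and [mx_irreducible] refer to row vectors, that
   is to bras: the row space of eigenspace A a consists of the v such that
   v *m A = a *: v.  For Hermitian A and unitary representations, taking
   adjoints turns them into the corresponding notions for kets. *)
Definition lambda_min (C : numClosedFieldType) (d : nat) (A : 'M[C]_d) : C :=
  minimum [set a | eigenvalue A a].

Lemma hermsymmx_eigenvalue_real (C : numClosedFieldType) (d : nat)
    (A : 'M[C]_d) (a : C) :
  A \is hermsymmx -> eigenvalue A a -> a \is Num.real.
Proof.
move=> /is_hermitianmxP; rewrite expr0 scale1r => hA /eigenvalueP[v vA v0].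
have nv : (v *m v^t*) 0 0 != 0.
  by rewrite -dotmxE; apply: contraNneq v0 => /eqP; rewrite dnorm_eq0.
have e1 : v *m A *m v^t* = a *: (v *m v^t*) by rewrite vA scalemxAl.
have e2 : v *m A *m v^t* = a^* *: (v *m v^t*).
  have vA' : A *m v^t* = a^* *: v^t*.
    by rewrite {1}hA -map_mxM -trmx_mul vA linearZ /= map_mxZ.
  by rewrite -mulmxA vA' scalemxAr.
have /(congr1 (fun M : 'M_1 => M 0 0)) := etrans (esym e1) e2.
by rewrite [LHS]mxE [RHS]mxE => /(mulIf nv) aE; apply/CrealP; rewrite -aE.
Qed.

Lemma lambda_minP (C : numClosedFieldType) (d : nat) (A : 'M[C]_d) :
  (0 < d)%N -> A \is hermsymmx ->
  is_minimum [set a | eigenvalue A a] (lambda_min A).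
Proof.
move=> d0 hA.
have [s sE] := closed_field_poly_normal (char_poly A).
have sP a : eigenvalue A a = (a \in s).
  rewrite eigenvalue_root_char sE (monicP (char_poly_monic A)) scale1r.
  by rewrite root_prod_XsubC.
have sR : {in s, forall a, a \is Num.real}.
  by move=> a; rewrite -sP; apply: hermsymmx_eigenvalue_real.
have [a0] := eigenvalue_closed A d0; rewrite sP => a0s.
suff [m ms mP] : exists2 m, m \in s & {in s, forall a, m <= a}.
  apply: (@minimumP _ _ m); split; rewrite /= ?sP //.
  by move=> a /=; rewrite sP; apply: mP.
elim: s a0 a0s sR {sE sP} => // x s IH a0 _ sR.
have xR : x \is Num.real by apply: sR; rewrite mem_head.
case: s IH sR => [|y s] IH sR.
  by exists x; rewrite ?mem_head // => a; rewrite inE => /eqP ->.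
have [||m ms mP] := IH y; first exact: mem_head.
  by move=> a as_; apply: sR; rewrite inE as_ orbT.
have mR : m \is Num.real by apply: sR; rewrite inE ms orbT.
case: (real_leP xR mR) => [xm|/ltW mx].
  exists x; first exact: mem_head.
  by move=> a; rewrite inE => /orP[/eqP -> //|/mP]; apply: le_trans.
exists m; first by rewrite inE ms orbT.
by move=> a; rewrite inE => /orP[/eqP -> //|/mP].
Qed.

Definition orthogonal_projection (C : numClosedFieldType) (d : nat)
    (P : 'M[C]_d) : Prop :=
  P \is hermsymmx /\ P *m P = P.

(* Families indexed by G are functions on the ambient type gT; their values
   outside G are never used. *)
Definition povm (C : numClosedFieldType) (gT : finGroupType) (G : {group gT})
    (d : nat) (Pi : gT -> 'M[C]_d) : Prop :=
  (forall g, g \in G -> psdmx (Pi g)) /\ \sum_(g in G) Pi g = 1%:M.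

Definition gu_state (C : numClosedFieldType) (gT : finGroupType)
    (G : {group gT}) (d : nat) (U : mx_representation C G d) (rho : 'M[C]_d)
    (g : gT) : 'M[C]_d :=
  U g *m rho *m (U g)^t*.

Definition exclusion_error (C : numClosedFieldType) (gT : finGroupType)
    (G : {group gT}) (d : nat) (U : mx_representation C G d) (rho : 'M[C]_d)
    (Pi : gT -> 'M[C]_d) : C :=
  #|G|%:R^-1 * \sum_(g in G) \tr (Pi g *m gu_state U rho g).

Definition exclusion_errors (C : numClosedFieldType) (gT : finGroupType)
    (G : {group gT}) (d : nat) (U : mx_representation C G d)
    (rho : 'M[C]_d) : set C :=
  [set q | exists2 Pi, povm G Pi & q = exclusion_error U rho Pi].

Definition optimal_exclusion_error (C : numClosedFieldType)
    (gT : finGroupType) (G : {group gT}) (d : nat)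
    (U : mx_representation C G d) (rho : 'M[C]_d) : C :=
  minimum (exclusion_errors U rho).

(* Main.v *)
(* Lower bound: conjugating by the unitary g turns tr (Pi_g rho_g) into the
   trace of a positive semidefinite matrix of trace tr Pi_g against rho, which
   is at least lambda_min(rho) tr Pi_g; the traces tr Pi_g add up to d.
   Equality: the twirl of P commutes with the irreducible representation, so by
   Schur's lemma it is the scalar nk/d, whence the measurement is a POVM; as P
   lives on the minimal eigenspace, each of its terms meets the bound. *)
Require Import Defs.
From mathcomp Require Import all_boot all_order all_algebra all_fingroup all_character.
From mathcomp Require Import boolp classical_sets reals.
From mathcomp Require Import complex.

Set Implicit Arguments.
Unset Strict Implicit.
Unset Printing Implicit Defensive.

Import Order.TTheory GRing.Theory Num.Theory.
Local Open Scope ring_scope.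
Local Open Scope sesquilinear_scope.

(** * Adjoints and positive semidefinite matrices *)

Lemma adjmxM (C : numClosedFieldType) (m n p : nat) (A : 'M[C]_(m, n))
    (B : 'M[C]_(n, p)) : (A *m B)^t* = B^t* *m A^t*.
Proof. by rewrite trmx_mul map_mxM. Qed.

Lemma hermsymmxP (C : numClosedFieldType) (d : nat) (A : 'M[C]_d) :
  A \is hermsymmx <-> A^t* = A.
Proof.
split=> [/is_hermitianmxP|hA]; first by rewrite expr0 scale1r => <-.
by apply/is_hermitianmxP; rewrite expr0 scale1r hA.
Qed.

Lemma psdmx_conj (C : numClosedFieldType) (m d : nat) (V : 'M[C]_(m, d))
    (A : 'M[C]_d) : psdmx A -> psdmx (V *m A *m V^t*).
Proof.
move=> [/hermsymmxP hA pA]; split=> [|u].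
  by apply/hermsymmxP; rewrite !adjmxM trmxCK hA mulmxA.
by have := pA (V^t* *m u); rewrite adjmxM trmxCK !mulmxA.
Qed.

Lemma psdmx_scale (C : numClosedFieldType) (d : nat) (a : C) (A : 'M[C]_d) :
  0 <= a -> psdmx A -> psdmx (a *: A).
Proof.
move=> a0 [/hermsymmxP hA pA]; split=> [|u].
  by apply/hermsymmxP; rewrite linearZ /= map_mxZ hA /= geC0_conj.
by rewrite -scalemxAr -scalemxAl mxE mulr_ge0.
Qed.

Lemma psdmx_gram (C : numClosedFieldType) (m d : nat) (B : 'M[C]_(d, m)) :
  psdmx (B *m B^t*).
Proof.
split=> [|u]; first by apply/hermsymmxP; rewrite adjmxM trmxCK.
have -> : u^t* *m (B *m B^t*) *m u = (u^t* *m B) *m (u^t* *m B)^t*.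
  by rewrite adjmxM trmxCK !mulmxA.
by rewrite -dotmxE dnorm_ge0.
Qed.

(** * Projections, their trace and rank *)

Lemma orthogonal_projection_psd (C : numClosedFieldType) (d : nat)
    (P : 'M[C]_d) : orthogonal_projection P -> psdmx P.
Proof.
by move=> [/hermsymmxP hP PP]; rewrite -PP -{2}hP; apply: psdmx_gram.
Qed.

(** A rank factorization [P = K *m R] has [K] left-cancellable and [R] right-cancellable, so
    [P *m P = P] forces [R *m K] to be the identity of size [\rank P]; cyclicity of the trace does
    the rest. *)
Lemma mxtrace_idempotent (F : fieldType) (d : nat) (P : 'M[F]_d) :
  P *m P = P -> \tr P = (\rank P)%:R.
Proof.
move=> PP; rewrite -{1}[P]mulmx_base mxtrace_mulC.
suff -> : row_base P *m col_base P = 1%:M by rewrite mxtrace1.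
apply: (@row_full_inj _ _ _ _ (col_base P)); first exact: col_base_full.
apply: (@row_free_inj _ _ _ _ (row_base P)); first exact: row_base_free.
by rewrite mulmx1 mulmxA mulmx_base -mulmxA mulmx_base PP.
Qed.

(** Supplies the projection that makes the lower bound attained. As eigenvectors are rows here, the
    projector onto the line of [v] is [v^t* *m v] divided by the squared norm of [v]. *)
Lemma eigenvector_projection (C : numClosedFieldType) (d : nat)
    (A : 'M[C]_d) (a : C) : eigenvalue A a ->
  exists P : 'M[C]_d, [/\ orthogonal_projection P, \rank P = 1%N
                        & (P <= eigenspace A a)%MS].
Proof.
move=> /eigenvalueP[v vA v0].
have nv : (v *m v^t*) 0 0 != 0.
  by rewrite -dotmxE; apply: contraNneq v0 => /eqP; rewrite dnorm_eq0.
have nv0 : 0 <= (v *m v^t*) 0 0 by rewrite -dotmxE dnorm_ge0.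
set c := (v *m v^t*) 0 0 in nv nv0.
have vv : v *m v^t* = c%:M by rewrite [LHS]mx11_scalar.
have PP : orthogonal_projection (c^-1 *: (v^t* *m v)).
  split.
    apply/hermsymmxP; rewrite linearZ /= map_mxZ adjmxM trmxCK /=.
    by rewrite geC0_conj ?invr_ge0.
  rewrite -scalemxAl -scalemxAr mulmxA -(mulmxA _ v) vv mul_mx_scalar.
  by rewrite -scalemxAl [c^-1 *: (c *: _)]scalerA mulVf // scale1r.
exists (c^-1 *: (v^t* *m v)); split=> //.
  (* The rank is read off from the trace, natural numbers being embedded faithfully in [C]. *)
  apply/eqP; rewrite -(@eqr_nat C) -mxtrace_idempotent; last exact: PP.2.
  by rewrite mxtraceZ mxtrace_mulC vv mxtrace_scalar mulr1n mulVf.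
rewrite scalemx_sub // mulmx_sub //; exact/eigenspaceP.
Qed.

(** * Spectral decomposition and the trace bound *)

Lemma eigenvalue_spectral_diag (C : numClosedFieldType) (d : nat)
    (A : 'M[C]_d) (i : 'I_d) :
  A \is normalmx -> eigenvalue A (spectral_diag A 0 i).
Proof.
move=> /orthomx_spectralP AE; set V := spectralmx A.
have Vu : V \in unitmx by apply: spectral_unit.
apply/eigenvalueP; exists (row i V).
  have VA : V *m A = diag_mx (spectral_diag A) *m V.
    by rewrite {1}AE !mulmxA mulmxV // mul1mx.
  by rewrite -row_mul VA mul_diag_mx; apply/rowP => j; rewrite !mxE.
(* If row [i] of the invertible [V] vanished, so would the basis vector [delta_mx 0 i]. *)
rewrite rowE; apply/eqP => /(congr1 (mulmx^~ (invmx V))).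
rewrite mulmxK // mul0mx => /matrixP/(_ 0 i)/eqP.
by rewrite !mxE !eqxx oner_eq0.
Qed.

(** In an orthonormal eigenbasis of [B], the trace of [A *m B] is the sum of the eigenvalues of [B]
    weighted by the diagonal entries of the conjugate [W] of [A]; these weights are nonnegative and
    add up to [\tr A]. *)
Lemma psdmx_mxtrace_ge (C : numClosedFieldType) (d : nat) (A B : 'M[C]_d)
    (l : C) : psdmx A -> B \is hermsymmx ->
  (forall a, eigenvalue B a -> l <= a) -> l * \tr A <= \tr (A *m B).
Proof.
move=> pA hB lB; have nB := hermitian_normalmx hB.
have /orthomx_spectralP BE := nB; set V := spectralmx B in BE.
have Vu : V \is unitarymx by apply: spectral_unitarymx.
have [_ pW] := psdmx_conj V pA; set W := V *m A *m V^t* in pW.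
have -> : \tr (A *m B) = \tr (W *m diag_mx (spectral_diag B)).
  by rewrite {1}BE invmx_unitary // !mulmxA mxtrace_mulC !mulmxA.
have -> : \tr A = \tr W.
  by rewrite mxtrace_mulC mulmxA -invmx_unitary // mulVmx ?mul1mx ?unitarymx_unit.
rewrite /mxtrace mulr_sumr; apply: ler_sum => i _.
rewrite mul_mx_diag [leRHS]mxE mulrC ler_wpM2l //; last first.
  by apply: lB; apply: eigenvalue_spectral_diag.
(* A diagonal entry of [W] is its quadratic form at a basis vector. *)
have := pW (delta_mx i 0); congr (0 <= _).
have -> : (delta_mx i 0 : 'cV[C]_d)^t* = delta_mx 0 i.
  by rewrite trmx_delta map_delta_mx.
by rewrite -rowE -colE !mxE.
Qed.

(** * Schur's lemma and unitary conjugation *)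

Lemma mx_irreducible_gt0 (F : fieldType) (gT : finGroupType) (G : {group gT})
    (d : nat) (U : mx_representation F G d) : mx_irreducible U -> (0 < d)%N.
Proof.
case=> _ I0 _; rewrite lt0n; apply: contraNneq I0 => d0.
by apply/eqP/matrixP => i; have := ltn_ord i; rewrite [ltnRHS]d0.
Qed.

(** For an eigenvalue [a] of [A], the matrix [A - a%:M] is singular and commutes with [U]; were it
    nonzero, Schur's lemma would make it invertible. *)
Lemma Schur_scalar (C : numClosedFieldType) (gT : finGroupType)
    (G : {group gT}) (d : nat) (U : mx_representation C G d) (A : 'M[C]_d) :
  mx_irreducible U -> centgmx U A -> exists a, A = a%:M.
Proof.
move=> irrU /centgmxP cA.
have d_gt0 := mx_irreducible_gt0 irrU.
have [a /eigenvalueP[v vA v0]] := eigenvalue_closed A d_gt0.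
exists a; apply/eqP; rewrite -subr_eq0; apply: contraNT v0 => Aa.
have cAa : centgmx U (A - a%:M).
  apply/centgmxP => g Gg.
  by rewrite mulmxBl mulmxBr cA // scalar_mxC.
have uAa := mx_Schur irrU cAa Aa.
apply/eqP/(can_inj (mulmxK uAa)).
by rewrite mul0mx mulmxBr vA mul_mx_scalar subrr.
Qed.

Lemma adjmx_unitaryK (C : numClosedFieldType) (d : nat) (V : 'M[C]_d) :
  V \is unitarymx -> V^t* *m V = 1%:M.
Proof. by move=> Vu; rewrite -invmx_unitary // mulVmx ?unitarymx_unit. Qed.

Lemma mxtrace_unitary_conj (C : numClosedFieldType) (d : nat)
    (V A : 'M[C]_d) : V \is unitarymx -> \tr (V *m A *m V^t*) = \tr A.
Proof. by move=> Vu; rewrite mxtrace_mulC mulmxA adjmx_unitaryK // mul1mx. Qed.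

(** * Twirling, the lower bound and covariant measurements *)

Section UnitaryRepresentation.
Variables (C : numClosedFieldType) (gT : finGroupType) (G : {group gT}).
Variables (d : nat) (U : mx_representation C G d).
Hypothesis U_unitary : forall g, g \in G -> U g \is unitarymx.

Lemma twirl_scalar (A : 'M[C]_d) : mx_irreducible U ->
  \sum_(g in G) U g *m A *m (U g)^t* = (#|G|%:R * \tr A / d%:R)%:M.
Proof.
move=> irrU; set T := \sum_(g in G) _.
have d0 : d%:R != 0 :> C by rewrite pnatr_eq0 -lt0n (mx_irreducible_gt0 irrU).
have cT : centgmx U T.
  apply/centgmxP => h Gh.
  (* For unitary [U h], commuting with [T] amounts to fixing it by conjugation, which only permutes
     the summands through the translation of [G] by [h]. *)
  suff TE : U h *m T *m (U h)^t* = T.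
    by rewrite -{1}TE -(mulmxA _ _ (U h)) adjmx_unitaryK ?U_unitary ?mulmx1.
  rewrite mulmx_sumr mulmx_suml [RHS](reindex_inj (mulgI h)) /=.
  apply: eq_big => g; first by rewrite groupMl.
  by move=> Gg; rewrite repr_mxM // adjmxM !mulmxA.
have [a TE] := Schur_scalar irrU cT; rewrite TE; congr _%:M.
(* The scalar is determined by its trace, to which each summand contributes [\tr A]. *)
have : \tr T = #|G|%:R * \tr A.
  rewrite raddf_sum (eq_bigr (fun=> \tr A)) => [|g Gg].
    by rewrite sumr_const mulr_natl.
  by rewrite /= mxtrace_unitary_conj ?U_unitary.
by move<-; rewrite TE mxtrace_scalar -[a *+ d]mulr_natr mulfK.
Qed.

Lemma exclusion_error_ge (rho : 'M[C]_d) (l : C) (Pi : gT -> 'M[C]_d) :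
  rho \is hermsymmx -> (forall a, eigenvalue rho a -> l <= a) ->
  povm G Pi -> d%:R * l / #|G|%:R <= exclusion_error U rho Pi.
Proof.
move=> hrho lrho [pPi sPi].
rewrite /exclusion_error mulrC ler_wpM2l ?invr_ge0 ?ler0n //.
have -> : d%:R * l = \sum_(g in G) l * \tr (Pi g).
  by rewrite -mulr_sumr -raddf_sum sPi /= mxtrace1 mulrC.
apply: ler_sum => g Gg; have Ug := U_unitary Gg.
(* The conjugation is put on [Pi g], so that the bound is applied with the fixed matrix [rho] for
   all [g]. *)
have := psdmx_mxtrace_ge (psdmx_conj ((U g)^t*) (pPi g Gg)) hrho lrho.
rewrite mxtrace_unitary_conj ?trmxC_unitary // trmxCK.
by rewrite /gu_state -!mulmxA [in leRHS]mxtrace_mulC -!mulmxA.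
Qed.

Section CovariantMeasurement.
Variables (P : 'M[C]_d) (k : nat).
Hypotheses (U_irr : mx_irreducible U) (P_proj : orthogonal_projection P).
Hypotheses (P_rank : \rank P = k) (k_gt0 : (0 < k)%N).

(** The factor is the inverse of the scalar [#|G| k / d] to which [P], of trace [k], twirls. *)
Let Pi (g : gT) := (d%:R / (#|G|%:R * k%:R)) *: (U g *m P *m (U g)^t*).

Let d_neq0 : d%:R != 0 :> C.
Proof. by rewrite pnatr_eq0 -lt0n (mx_irreducible_gt0 U_irr). Qed.

Let k_neq0 : k%:R != 0 :> C.
Proof. by rewrite pnatr_eq0 -lt0n. Qed.

Let G_neq0 : #|G|%:R != 0 :> C.
Proof. by rewrite pnatr_eq0 -lt0n cardG_gt0. Qed.

Let P_trace : \tr P = k%:R.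
Proof. by rewrite mxtrace_idempotent ?P_rank //; case: P_proj. Qed.

Lemma povm_covariant : povm G Pi.
Proof.
split=> [g Gg|].
  apply: psdmx_scale; first by rewrite divr_ge0 ?mulr_ge0 ?ler0n.
  exact/psdmx_conj/orthogonal_projection_psd.
rewrite -scaler_sumr twirl_scalar // scale_scalar_mx P_trace.
by rewrite mulrA divfK ?mulf_neq0 // mulfV.
Qed.

Lemma exclusion_error_covariant (rho : 'M[C]_d) (l : C) :
  (P <= eigenspace rho l)%MS ->
  exclusion_error U rho Pi = d%:R * l / #|G|%:R.
Proof.
move=> /eigenspaceP Prho.
rewrite /exclusion_error (eq_bigr (fun=> d%:R * l / #|G|%:R)) => [|g Gg].
  by rewrite sumr_const -[X in _ * X]mulr_natl mulKf.
(* The inner unitaries cancel, leaving [P *m rho], which is [l *: P] because the rows of [P] are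
   left eigenvectors of [rho]. *)
have -> : Pi g *m gu_state U rho g =
    (d%:R / (#|G|%:R * k%:R) * l) *: (U g *m P *m (U g)^t*).
  rewrite -scalemxAl /gu_state !mulmxA -(mulmxA _ ((U g)^t*)).
  rewrite adjmx_unitaryK ?U_unitary // mulmx1 -(mulmxA _ P) Prho.
  by rewrite -scalemxAr -scalemxAl scalerA.
rewrite mxtraceZ mxtrace_unitary_conj ?U_unitary // P_trace.
by rewrite invfM mulrA mulrAC divfK // mulrAC.
Qed.

End CovariantMeasurement.

Lemma exclusion_errors_minimum (rho : 'M[C]_d) :
  mx_irreducible U -> rho \is hermsymmx ->
  is_minimum (exclusion_errors U rho) (d%:R * lambda_min rho / #|G|%:R).
Proof.
move=> irrU hrho.
have [ev lb] := lambda_minP (mx_irreducible_gt0 irrU) hrho.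
split=> [|_ [Pi povmPi ->]]; last exact: exclusion_error_ge.
have [P [projP rkP subP]] := eigenvector_projection ev.
(* The minimum is attained by the covariant measurement with [k = 1]. *)
eexists; first exact: (povm_covariant irrU projP rkP isT).
by rewrite (exclusion_error_covariant projP rkP isT subP).
Qed.

End UnitaryRepresentation.

(** * Positivity of the smallest eigenvalue *)

Lemma psdmx_eigenvalue_ge0 (C : numClosedFieldType) (d : nat) (A : 'M[C]_d)
    (a : C) : psdmx A -> eigenvalue A a -> 0 <= a.
Proof.
move=> [_ pA] /eigenvalueP[v vA v0]; have := pA (v^t*).
rewrite trmxCK vA -scalemxAl mxE pmulr_lge0 // -dotmxE.
by rewrite lt_def dnorm_ge0 dnorm_eq0 v0.
Qed.

(** The eigenvalues being nonnegative, the smallest one fails to be positive exactly when 0 is an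
    eigenvalue, that is, when [A] is singular. *)
Lemma lambda_min_gt0 (C : numClosedFieldType) (d : nat) (A : 'M[C]_d) :
  (0 < d)%N -> psdmx A -> 0 < lambda_min A <-> \rank A = d.
Proof.
move=> d0 pA; have [ev lb] := lambda_minP d0 pA.1.
have ev0 : eigenvalue A 0 = (\rank A != d).
  rewrite /eigenvalue /eigenspace raddf0 subr0 -mxrank_eq0 mxrank_ker.
  by rewrite subn_eq0 eqn_leq rank_leq_row.
split=> [l0|rk].
  apply/eqP; apply: contraTT l0; rewrite -ev0 => /lb l0.
  by apply/negP => /lt_le_trans/(_ l0); rewrite ltxx.
rewrite lt_def (psdmx_eigenvalue_ge0 pA ev) andbT.
by apply: contraPneq ev => ->; rewrite /= ev0 rk eqxx.
Qed.

Theorem mainTheorem6 (R : realType) (gT : finGroupType) (G : {group gT})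
    (d : nat) (U : mx_representation R[i] G d) (rho : 'M[R[i]]_d)
    (U_unitary : forall g, g \in G -> U g \is unitarymx)
    (U_irreducible : mx_irreducible U)
    (rho_state : quantum_state rho) :
  [/\ is_minimum (exclusion_errors U rho) (optimal_exclusion_error U rho),
      optimal_exclusion_error U rho = d%:R * lambda_min rho / #|G|%:R,
      0 < optimal_exclusion_error U rho <-> \rank rho = d
    & forall (P : 'M[R[i]]_d) (k : nat),
        orthogonal_projection P -> \rank P = k -> (1 <= k)%N ->
        (P <= eigenspace rho (lambda_min rho))%MS ->
        let Pi := fun g : gT =>
          (d%:R / (#|G|%:R * k%:R)) *: (U g *m P *m (U g)^t*) in
        povm G Pi /\
        exclusion_error U rho Pi = optimal_exclusion_error U rho].
Proof.
have [psd_rho _] := rho_state.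
have min_q := exclusion_errors_minimum U_unitary U_irreducible psd_rho.1.
have d_gt0 := mx_irreducible_gt0 U_irreducible.
have qE : optimal_exclusion_error U rho = d%:R * lambda_min rho / #|G|%:R.
  exact: minimumE min_q.
split=> //; first by rewrite qE.
  (* As [d] and [#|G|] are positive, the optimal error is positive exactly when [lambda_min rho]
     is. *)
  rewrite qE pmulr_lgt0 ?invr_gt0 ?ltr0n ?cardG_gt0 // pmulr_rgt0 ?ltr0n //.
  exact: lambda_min_gt0.
move=> P k projP rkP k_gt0 subP Pi; split; first exact: povm_covariant.
by rewrite qE (exclusion_error_covariant U_unitary projP rkP k_gt0 subP).
Qed.
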